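(* For all integers $v\ge4$ and $d\ge1$, \[\sum_{D\in\mathcal{D}_{v,d}(231,312,321)} x^{des(\pi_D)} = (1+x)^{d-1}\left(\sum_{k=0}^{\lfloor\frac{v-2}{2}\rfloor}\binom{v-2-k}{k}x^k\right)^{d}.\]
   Context: A diamond with $v$ vertices ($v\ge4$) is the poset with a least element, a greatest element, and $v-2$ pairwise incomparable middle elements (in a fixed left-to-right order) strictly between them. $\mathcal{D}_{v,d}$ is the set of labellings of $d$ diamonds (placed left to right) by $1,\dots,vd$, each label used once, such that in each diamond least label $<$ each middle label $<$ greatest label. For $D\in\mathcal{D}_{v,d}$, $\pi_D$ is the permutation obtained by reading the diamonds left to right and, within each diamond, the least element, then the middle elements left to right, then the greatest element. $\mathcal{D}_{v,d}(P)$ is the set of $D$ with $\pi_D$ avoiding every classical pattern in $P$. $des(\pi)$ is the number of $i$ with $\pi_i>\pi_{i+1}$. *)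

(* Defs.v *)
From mathcomp Require Import all_boot all_order all_algebra.

Set Implicit Arguments.
Unset Strict Implicit.
Unset Printing Implicit Defensive.

(* Strict order of the diamond on 'I_v: 0 is the least element, v.-1 the
   greatest, and 1, ..., v-2 are the middle elements from left to right. *)
Definition diamond_lt (v : nat) (a b : 'I_v) : bool :=
  ((a == 0 :> nat) && (0 < b)) || ((a < v.-1) && (b == v.-1 :> nat)).

(* D (i, a) is the label of element a of the i-th diamond from the left; the
   label l in {1, ..., v * d} is encoded by the ordinal of value l - 1. *)
Definition labelling (v d : nat) : finType :=
  {ffun 'I_d * 'I_v -> 'I_(v * d)}.

(* Injectivity suffices for "each label is used once": domain and codomain
   have the same cardinality. *)
Definition diamonds (v d : nat) : {set labelling v d} :=
  [set D : labelling v d | injectiveb D &&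
     [forall i : 'I_d, forall a : 'I_v, forall b : 'I_v,
        diamond_lt a b ==> (D (i, a) < D (i, b))]].

Definition reading (v d : nat) (D : labelling v d) : seq nat :=
  [seq (D (i, a)).+1 | i <- enum 'I_d, a <- enum 'I_v].

Definition order_iso (s t : seq nat) : bool :=
  (size s == size t) &&
  [forall i : 'I_(size s), forall j : 'I_(size s),
     (nth 0 s i < nth 0 s j) == (nth 0 t i < nth 0 t j)].

Definition contains_pattern (w p : seq nat) : bool :=
  [exists m : (size w).-tuple bool, order_iso (mask m w) p].

Definition diamonds_avoiding (v d : nat) (P : seq (seq nat)) :
    {set labelling v d} :=
  [set D in diamonds v d |
     all (fun p => ~~ contains_pattern (reading D) p) P].

Definition des (w : seq nat) : nat :=
  #|[set i : 'I_(size w).-1 | nth 0 w i.+1 < nth 0 w i]|.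

(* Main.v *)
Require Import Defs.
From mathcomp Require Import all_boot all_order all_algebra zify ring.

(* A permutation avoids 231, 312 and 321 iff entries at distance at least two
   are in increasing order.  It is then determined by its descent set, which can
   be any set of positions without two consecutive elements.  The diamond
   condition only forbids a descent after the least element and one before the
   greatest element of each diamond.  Hence the v - 3 positions inside a diamond
   contribute a Fibonacci polynomial, and each of the d - 1 boundaries between
   diamonds, isolated by forbidden positions, contributes a free factor 1 + x. *)

Set Implicit Arguments.
Unset Strict Implicit.
Unset Printing Implicit Defensive.

Local Notation forbidden_patterns :=
  [:: [:: 2; 3; 1]; [:: 3; 1; 2]; [:: 3; 2; 1]].

Lemma subseq_nthP (T : eqType) (x0 : T) (u w : seq T) :
  reflect (exists2 s, sorted ltn s && all (gtn (size w)) s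
                    & u = [seq nth x0 w i | i <- s])
          (subseq u w).
Proof.
apply: (iffP subseqP) => [[m _ ->]|[s /andP[s_sorted /allP s_lt] ->]].
  exists (mask m (iota 0 (size w))); last first.
    by rewrite map_mask -/(mkseq _ _) mkseq_nth.
  rewrite (subseq_sorted ltn_trans (mask_subseq _ _) (iota_ltn_sorted _ _)) /=.
  by apply/allP=> i /mem_mask; rewrite mem_iota.
apply/subseqP; rewrite -{2}(mkseq_nth x0 w); apply: map_subseq.
have -> : s = [seq i <- iota 0 (size w) | i \in s].
  apply: (irr_sorted_eq ltn_trans ltnn) => //.
    exact/(sorted_filter ltn_trans)/iota_ltn_sorted.
  move=> i; rewrite mem_filter mem_iota add0n /=.
  by case: (boolP (i \in s)) => // /s_lt.
exact: filter_subseq.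
Qed.

Lemma uniq_subset_perm (T : eqType) (s t : seq T) :
  uniq s -> {subset s <= t} -> size t <= size s -> perm_eq s t.
Proof.
move=> s_uniq sub_st le_sz; apply: uniq_perm => //.
  exact: leq_size_uniq sub_st le_sz.
exact: (uniq_min_size s_uniq sub_st le_sz).2.
Qed.

Lemma mem_map_cons (T : eqType) (x : T) (u : seq T) (s : seq (seq T)) :
  (u \in map (cons x) s) =
  (if u is y :: u' then (y == x) && (u' \in s) else false).
Proof.
apply/mapP/idP => [[u' u'_in ->]|]; first by rewrite eqxx.
by case: u => // y u' /andP[/eqP-> u'_in]; exists u'.
Qed.

Lemma nth_allpairs (S T R : Type) (f : S -> T -> R) (s : seq S) (t : seq T)
    (x0 : S) (y0 : T) (z0 : R) (i j : nat) : i < size s -> j < size t ->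
  nth z0 [seq f x y | x <- s, y <- t] (i * size t + j) =
  f (nth x0 s i) (nth y0 t j).
Proof.
elim: s i => [|x s IH] [|i] //= lt_i lt_j; rewrite nth_cat size_map.
  by rewrite add0n lt_j (nth_map y0).
rewrite mulSn -addnA ltnNge leq_addr /= addKn; exact: IH.
Qed.

Lemma nth_true_lt (b : bitseq) (i : nat) : nth false b i -> i < size b.
Proof.
by move=> bi; rewrite ltnNge; apply/negP=> /(nth_default false); rewrite bi.
Qed.

Lemma all2_implbP (b A : bitseq) :
  reflect (size b = size A /\ forall i, nth false b i -> nth false A i)
          (all2 implb b A).
Proof.
elim: b A => [|x b IH] [|a A] /=; try by constructor; case.
  by constructor; split.
apply: (iffP andP) => [[xa /IH[sz le_bA]]|[[sz] le_bA]].
  by split; [rewrite sz|case=> //=; apply/implyP].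
by split; [apply/implyP/(le_bA 0)|apply/IH; split=> // i; apply: (le_bA i.+1)].
Qed.

Lemma count_gtn_inj (s : seq nat) :
  {in s &, injective (fun x => count (gtn x) s)}.
Proof.
have mono x y : x \in s -> x < y -> count (gtn x) s < count (gtn y) s.
  move=> xs lt_xy; rewrite !(permP (perm_to_rem xs)) /= ltnn lt_xy ltnS.
  by apply: sub_count => z /= /ltn_trans; apply.
move=> x y xs ys eq_count.
case: (ltngtP x y) => // [/(mono x y xs)|/(mono y x ys)];
  by rewrite eq_count ltnn.
Qed.

Lemma uniq_nth_ltnNgt (w : seq nat) (i j : nat) :
  uniq w -> i != j -> i < size w -> j < size w ->
  (nth 0 w i < nth 0 w j) = ~~ (nth 0 w j < nth 0 w i).
Proof.
by move=> w_uniq ne_ij lt_i lt_j; rewrite -leqNgt ltn_neqAle nth_uniq ?ne_ij.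
Qed.

Lemma order_isoP (s t : seq nat) :
  reflect (size s = size t /\ forall i j, i < size s -> j < size s ->
             (nth 0 s i < nth 0 s j) = (nth 0 t i < nth 0 t j))
          (order_iso s t).
Proof.
apply: (iffP andP) => [[/eqP eq_sz /forallP iso]|[-> iso]].
  split=> // i j lt_i lt_j.
  by have /forallP/(_ (Ordinal lt_j))/eqP := iso (Ordinal lt_i).
by split=> //; apply/forallP=> i; apply/forallP=> j; apply/eqP/iso.
Qed.

(* The rank of an entry is invariant under order isomorphism, and within a fixed
   multiset of entries the rank determines the entry. *)
Lemma order_iso_perm_eq (s t : seq nat) : order_iso s t -> perm_eq s t -> s = t.
Proof.
move=> /order_isoP[eq_sz iso] perm_st; apply: (@eq_from_nth _ 0) => // i lt_i.
have lt_i' : i < size t by rewrite -eq_sz.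
apply: (@count_gtn_inj t); rewrite ?mem_nth // -?(perm_mem perm_st) ?mem_nth //.
rewrite -(permP perm_st) -[X in count _ X = _](mkseq_nth 0 s).
rewrite -[X in _ = count _ X](mkseq_nth 0 t) !count_map eq_sz.
apply: eq_in_count => j; rewrite mem_iota add0n /= => lt_j.
by rewrite iso ?eq_sz.
Qed.

Lemma contains_patternP (w p : seq nat) :
  reflect (exists2 u, subseq u w & order_iso u p) (contains_pattern w p).
Proof.
apply: (iffP existsP) => [[m]|[u /subseqP[m sz_m ->] iso]].
  by exists (mask m w) => //; apply: mask_subseq.
by exists (Tuple (introT eqP sz_m)).
Qed.

Lemma has_order_iso_231_312_321 (x y z : nat) : uniq [:: x; y; z] ->
  has (order_iso [:: x; y; z]) forbidden_patterns = (z < x).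
Proof.
move=> xyz_uniq; apply/hasP/idP => [[p p_in /order_isoP[_ iso]]|lt_zx].
  by have := iso 2 0 isT isT; move: p_in; rewrite !inE => /or3P[]/eqP->.
move: xyz_uniq; rewrite /= !inE negb_or => /and3P[/andP[ne_xy ne_xz] ne_yz _].
exists (if x < y then [:: 2; 3; 1] else if y < z then [:: 3; 1; 2]
        else [:: 3; 2; 1]); first by do 2?case: ifP.
apply/order_isoP; split; first by do 2?case: ifP.
by case: (ltnP x y) => ?; [|case: (ltnP y z) => ?];
  move=> [|[|[|?]]] [|[|[|?]]] //= _ _; lia.
Qed.

Definition far_increasing (w : seq nat) : Prop :=
  forall i k, i.+1 < k -> k < size w -> nth 0 w i < nth 0 w k.

Lemma avoids_231_312_321P (w : seq nat) : uniq w ->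
  reflect (far_increasing w)
          (all (fun p => ~~ contains_pattern w p) forbidden_patterns).
Proof.
move=> w_uniq; apply: (iffP allP) => [avoids i k lt_ik lt_k|far p p_in].
  rewrite uniq_nth_ltnNgt //; try lia.
  pose s := [:: i; i.+1; k].
  have sub_w : subseq [seq nth 0 w j | j <- s] w.
    apply/(subseq_nthP 0); exists s => //=; lia.
  rewrite -(has_order_iso_231_312_321 (subseq_uniq sub_w w_uniq)).
  apply/hasPn=> p /avoids; apply: contra => iso.
  by apply/contains_patternP; exists [seq nth 0 w j | j <- s].
apply/contains_patternP => -[u sub_w iso].
have sz_u : size u = 3.
  by have /order_isoP[-> _] := iso; move: p_in; rewrite !inE => /or3P[]/eqP->.
have u_uniq := subseq_uniq sub_w w_uniq.
have u_pattern : has (order_iso u) forbidden_patterns by apply/hasP; exists p.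
case/(subseq_nthP 0): sub_w => s s_lt def_u.
case: s s_lt def_u => [|i [|j [|k [|l s]]]] s_lt def_u;
  rewrite {}def_u // in sz_u u_uniq u_pattern.
by move: u_pattern s_lt (far i k); rewrite has_order_iso_231_312_321 //=; lia.
Qed.

Definition descents (w : seq nat) : bitseq :=
  mkseq (fun i => nth 0 w i.+1 < nth 0 w i) (size w).-1.

Lemma des_descents (w : seq nat) : des w = count id (descents w).
Proof.
rewrite /des cardsE cardE size_filter /descents /mkseq count_map.
by rewrite -val_enum_ord count_map enumT.
Qed.

Lemma nth_descents (w : seq nat) (i : nat) : i.+1 < size w ->
  nth false (descents w) i = (nth 0 w i.+1 < nth 0 w i).
Proof. by move=> lt_i; rewrite nth_mkseq //; lia. Qed.

Definition sparse (b : bitseq) : bool := sorted (fun x y => ~~ (x && y)) b.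

Lemma sparseP (b : bitseq) :
  reflect (forall i, ~~ (nth false b i && nth false b i.+1)) (sparse b).
Proof.
apply: (iffP (sortedP false)) => sparse_b i => [|_]; last exact: sparse_b.
by have [/sparse_b|/(nth_default _) ->] := ltnP i.+1 (size b); rewrite ?andbF.
Qed.

Lemma far_increasing_sparse_descents (w : seq nat) :
  far_increasing w -> sparse (descents w).
Proof.
move=> far; apply/sparseP=> i; apply/negP=> /andP[des_i des_i1].
have lt_i2 : i.+2 < size w by move/nth_true_lt: des_i1; rewrite size_mkseq; lia.
move: des_i des_i1; rewrite !nth_descents //; last by lia.
by have := far i i.+2 (ltnSn _) lt_i2; lia.
Qed.

Lemma far_increasing_order_iso (w w' : seq nat) : uniq w -> uniq w' ->
  far_increasing w -> far_increasing w' ->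
  size w = size w' -> descents w = descents w' -> order_iso w w'.
Proof.
move=> w_uniq w'_uniq far far' eq_sz eq_des; apply/order_isoP; split=> //.
have eq_inv i j : i < j -> j < size w ->
    (nth 0 w j < nth 0 w i) = (nth 0 w' j < nth 0 w' i).
  move=> lt_ij lt_j; have [->|lt_i1j] : j = i.+1 \/ i.+1 < j by lia.
    have [lt_i1|ge_i1] := ltnP i.+1 (size w); last by lia.
    by rewrite -!nth_descents -?eq_sz // eq_des.
  have lt_w := far i j lt_i1j lt_j.
  have lt_w' : nth 0 w' i < nth 0 w' j by apply: far' lt_i1j _; rewrite -eq_sz.
  by rewrite (leq_gtF (ltnW lt_w)) (leq_gtF (ltnW lt_w')).
move=> i j lt_i lt_j.
have [lt_ij|lt_ji|->] := ltngtP i j; last by rewrite !ltnn.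
  by rewrite !(@uniq_nth_ltnNgt _ i j) -?eq_sz ?eq_inv // ltn_eqF.
exact: eq_inv.
Qed.

(* If [b] is sparse, this is the product of the disjoint transpositions
   [(i, i.+1)] over the set bits [i]. *)
Definition swaps (b : bitseq) (i : nat) : nat :=
  if nth false b i then i.+1
  else if (0 < i) && nth false b i.-1 then i.-1 else i.

Definition swap_word (b : bitseq) : seq nat :=
  mkseq (fun i => (swaps b i).+1) (size b).+1.

Lemma swaps_le_size (b : bitseq) (i : nat) : i <= size b -> swaps b i <= size b.
Proof.
by rewrite /swaps; case: ifP => [/nth_true_lt|_]; [lia|case: ifP; lia].
Qed.

Lemma swapsK (b : bitseq) : sparse b -> involutive (swaps b).
Proof.
move=> /sparseP sparse_b i; rewrite {2}/swaps; case: ifP => [bi|bi].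
  by have := sparse_b i; rewrite /swaps bi /= => /negPf ->.
case: ifP => [/andP[i_gt0 b_pred]|no_pred]; rewrite /swaps.
  by rewrite b_pred prednK.
by rewrite bi no_pred.
Qed.

Lemma swaps_far_increasing (b : bitseq) (i k : nat) :
  sparse b -> i.+1 < k -> swaps b i < swaps b k.
Proof.
move=> /sparseP sparse_b lt_ik; have := sparse_b i; rewrite /swaps.
have [->|gt_k] : k = i.+2 \/ i.+2 < k by lia.
  by rewrite /=; do ![case: ifP => //=]; lia.
by do ![case: ifP => //=]; lia.
Qed.

Lemma swaps_descent (b : bitseq) (i : nat) :
  sparse b -> (swaps b i.+1 < swaps b i) = nth false b i.
Proof.
move=> /sparseP sparse_b; have := sparse_b i; rewrite /swaps /=.
by case: (nth false b i) => /=; do ![case: ifP => //=]; lia.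
Qed.

Lemma swap_word_sub_iota (b : bitseq) :
  {subset swap_word b <= iota 1 (size b).+1}.
Proof.
by move=> x /mapP[i]; rewrite !mem_iota => /andP[_ /swaps_le_size] ? ->; lia.
Qed.

Lemma swap_word_uniq (b : bitseq) : sparse b -> uniq (swap_word b).
Proof.
by move=> sparse_b; apply/mkseq_uniq/(inj_comp succn_inj)/inv_inj/swapsK.
Qed.

Lemma swap_word_far_increasing (b : bitseq) :
  sparse b -> far_increasing (swap_word b).
Proof.
move=> sparse_b i k lt_ik; rewrite size_mkseq => lt_k.
by rewrite !nth_mkseq ?ltnS ?swaps_far_increasing //; lia.
Qed.

Lemma descents_swap_word (b : bitseq) : sparse b -> descents (swap_word b) = b.
Proof.
move=> sparse_b; have sz : size (descents (swap_word b)) = size b.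
  by rewrite !size_mkseq.
apply: (@eq_from_nth _ false) => // i; rewrite sz => lt_i.
rewrite nth_descents ?size_mkseq // !nth_mkseq ?ltnS ?swaps_descent //.
exact: ltnW.
Qed.

Fixpoint sparse_words (c : bool) (A : bitseq) : seq bitseq :=
  if A is a :: A' then
    map (cons false) (sparse_words false A') ++
    (if a && ~~ c then map (cons true) (sparse_words true A') else [::])
  else [:: [::]].

Lemma mem_sparse_words (c : bool) (A b : bitseq) :
  (b \in sparse_words c A) = sparse (c :: b) && all2 implb b A.
Proof.
elim: A c b => [|a A IH] c [|x b] //=; first by rewrite andbF.
  by rewrite mem_cat mem_map_cons; case: ifP; rewrite ?mem_map_cons ?andbF.
rewrite mem_cat mem_map_cons IH.
by case: x; case: c; case: a; rewrite //= ?mem_map_cons ?IH ?andbF ?orbF.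
Qed.

Lemma mem_sparse_words_false (A b : bitseq) :
  (b \in sparse_words false A) = sparse b && all2 implb b A.
Proof. by rewrite mem_sparse_words; case: b. Qed.

Lemma sparse_words_uniq (c : bool) (A : bitseq) : uniq (sparse_words c A).
Proof.
elim: A c => //= a A IH c.
have cons_inj x : injective (cons x : bitseq -> bitseq) by move=> ? ? [].
rewrite cat_uniq map_inj_uniq //= IH /=.
case: ifP => // _; rewrite map_inj_uniq // IH andbT.
apply/hasPn=> b; rewrite !mem_map_cons.
by case: b => // x b /andP[/eqP-> _].
Qed.

Import GRing.Theory.
Local Open Scope ring_scope.

Section GeneratingFunctions.

Variables (R : pzSemiRingType) (x : R).
Implicit Types (c : bool) (A B : bitseq) (m k : nat).

Definition sparse_gf c A : R := \sum_(b <- sparse_words c A) x ^+ count id b.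

Lemma sparse_gf_nil c : sparse_gf c [::] = 1.
Proof. by rewrite /sparse_gf big_seq1. Qed.

Lemma sparse_gf_cons c a A :
  sparse_gf c (a :: A) =
  sparse_gf false A + (if a && ~~ c then x * sparse_gf true A else 0).
Proof.
rewrite /sparse_gf /= big_cat big_map /=; congr (_ + _).
case: ifP => _; last by rewrite big_nil.
by rewrite big_map mulr_sumr; apply: eq_bigr => b _; rewrite /= exprS.
Qed.

Lemma sparse_gf_cons_false c A : sparse_gf c (false :: A) = sparse_gf false A.
Proof. by rewrite sparse_gf_cons addr0. Qed.

Lemma sparse_gf_cat_false c A B :
  sparse_gf c (A ++ false :: B) = sparse_gf c A * sparse_gf false B.
Proof.
elim: A c => [|a A IH] c /=.
  by rewrite sparse_gf_cons_false sparse_gf_nil mul1r.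
by rewrite !sparse_gf_cons !IH; case: ifP => _; rewrite ?addr0 // mulrDl mulrA.
Qed.

Definition fib_poly m : R := \sum_(0 <= k < m.+1) x ^+ k *+ 'C(m - k, k).

Lemma fib_polySS m : fib_poly m.+2 = fib_poly m.+1 + x * fib_poly m.
Proof.
rewrite /fib_poly big_nat_recl // big_nat_recr //= subnn bin0n mulr0n addr0.
rewrite [in RHS]big_nat_recl // mulr_sumr -addrA; congr (_ + _).
rewrite -big_split /=; apply: eq_big_nat => k /andP[_ lt_k].
have -> : (m.+2 - k.+1 = (m - k).+1)%N by lia.
by rewrite binS mulrnDr subSS mulrnAr -exprS.
Qed.

Lemma fib_poly_half m :
  fib_poly m = \sum_(0 <= k < (m %/ 2).+1) x ^+ k *+ 'C(m - k, k).
Proof.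
rewrite /fib_poly (big_cat_nat (n := (m %/ 2).+1)) //=; last by lia.
rewrite [X in _ + X]big1_seq ?addr0 // => k /andP[_].
by rewrite mem_index_iota => lt_k; rewrite bin_small //; lia.
Qed.

Lemma sparse_gf_nseq k : sparse_gf false (nseq k true) = fib_poly k.+1.
Proof.
have [] //: sparse_gf false (nseq k true) = fib_poly k.+1 /\
            sparse_gf false (nseq k.+1 true) = fib_poly k.+2.
elim: k => [|k [IH IHS]].
  rewrite /fib_poly !big_nat_recl // !big_geq //= sparse_gf_cons !sparse_gf_nil.
  by rewrite /= !mulr0n !addr0 mulr1.
split=> //; rewrite fib_polySS -IHS -IH [in LHS]/= sparse_gf_cons /=.
by rewrite [sparse_gf true _]sparse_gf_cons andbF addr0.
Qed.

End GeneratingFunctions.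

Local Close Scope ring_scope.

Definition allows_descent (v a : nat) : bool := (a != 0) && (a != v - 2).

Definition allowed_descents (v n : nat) : bitseq :=
  mkseq (fun p => allows_descent v (p %% v)) n.

Lemma allowed_descents_single (v : nat) : 2 < v ->
  allowed_descents v v.-1 = false :: rcons (nseq (v - 3) true) false.
Proof.
move=> v_gt2; apply: (@eq_from_nth _ false) => [|p].
  by rewrite /= size_rcons size_nseq size_mkseq /=; lia.
rewrite size_mkseq => lt_p; rewrite nth_mkseq // /allows_descent.
rewrite modn_small; last by lia.
case: p lt_p => //= p lt_p; rewrite nth_rcons nth_nseq size_nseq if_same.
by case: ltnP; lia.
Qed.

Lemma allowed_descents_addl (v n : nat) : 2 < v ->
  allowed_descents v (v + n) =
  allowed_descents v v.-1 ++ true :: allowed_descents v n.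
Proof.
move=> v_gt2; have -> : v + n = v.-1.+1 + n by lia.
rewrite -cat_rcons /allowed_descents /mkseq iotaD map_cat; congr (_ ++ _).
  rewrite -/(mkseq _ _) mkseqS; congr (rcons _ _).
  by rewrite /allows_descent modn_small; lia.
rewrite add0n -[v.-1.+1]addn0 iotaDl -map_comp; apply: eq_map => p /=.
by rewrite prednK ?modnDl //; lia.
Qed.

Lemma sparse_gf_allowed_descents_start (R : pzSemiRingType) (x : R) (c : bool)
    (v n : nat) :
  sparse_gf x c (allowed_descents v n) =
  sparse_gf x false (allowed_descents v n).
Proof.
case: n => [|n]; first by rewrite !sparse_gf_nil.
by rewrite /allowed_descents /mkseq /= mod0n !sparse_gf_cons_false.
Qed.

Lemma sparse_gf_allowed_descents (R : comPzSemiRingType) (x : R) (v d : nat) :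
  2 < v ->
  sparse_gf x false (allowed_descents v (v * d.+1).-1) =
  ((1 + x) ^+ d * fib_poly x (v - 2) ^+ d.+1)%R.
Proof.
move=> v_gt2.
have gf_single B : sparse_gf x false (allowed_descents v v.-1 ++ B) =
    (fib_poly x (v - 2) * sparse_gf x false B)%R.
  rewrite allowed_descents_single //= cat_rcons sparse_gf_cons_false.
  by rewrite sparse_gf_cat_false sparse_gf_nseq subnSK.
elim: d => [|d IH].
  by rewrite muln1 -[allowed_descents _ _]cats0 gf_single sparse_gf_nil mulrC.
have -> : (v * d.+2).-1 = v + (v * d.+1).-1 by nia.
rewrite allowed_descents_addl // gf_single sparse_gf_cons.
by rewrite sparse_gf_allowed_descents_start IH /= !exprS; ring.
Qed.

Section Reading.

Variables v d : nat.
Implicit Types (D : labelling v d) (i : 'I_d) (a b : 'I_v).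

Lemma reading_codom D : reading D = [seq (val l).+1 | l <- codom D].
Proof. by rewrite codomE enumT unlock /= /prod_enum !map_allpairs. Qed.

Lemma size_reading D : size (reading D) = v * d.
Proof.
by rewrite reading_codom size_map size_codom card_prod !card_ord mulnC.
Qed.

Lemma reading_uniq D : uniq (reading D) = injectiveb D.
Proof. by rewrite reading_codom map_inj_uniq // => l l' [/val_inj]. Qed.

Lemma reading_sub_iota D : {subset reading D <= iota 1 (v * d)}.
Proof.
by rewrite reading_codom => x /mapP[l _ ->]; rewrite mem_iota /= add1n ltnS.
Qed.

Lemma nth_reading D i a : nth 0 (reading D) (i * v + a) = (D (i, a)).+1.
Proof.
have sz : size (enum 'I_v) = v by rewrite -cardE card_ord.
rewrite -{2}sz (nth_allpairs _ i a) ?sz -?cardE ?card_ord //.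
by rewrite !nth_ord_enum.
Qed.

Lemma position_lt i a : i * v + a < v * d.
Proof. by case: i a => i lt_i [a lt_a] /=; nia. Qed.

Lemma position_surj p : p < v * d ->
  exists i : 'I_d, exists a : 'I_v, p = i * v + a.
Proof.
move=> lt_p; have v_gt0 : 0 < v by case: v lt_p.
have lt_i : p %/ v < d by rewrite ltn_divLR // mulnC.
by exists (Ordinal lt_i), (Ordinal (ltn_pmod p v_gt0)); rewrite /= -divn_eq.
Qed.

Lemma reading_inj : injective (@reading v d).
Proof.
move=> D D' eq_reading; apply/ffunP=> -[i a]; apply/val_inj/succn_inj.
by rewrite /= -!nth_reading eq_reading.
Qed.

Lemma reading_surj (w : seq nat) :
  size w = v * d -> {subset w <= iota 1 (v * d)} -> exists D, reading D = w.
Proof.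
move=> sz_w sub_w.
have w_iota (x : 'I_d * 'I_v) : nth 0 w (x.1 * v + x.2) \in iota 1 (v * d).
  by apply/sub_w/mem_nth; rewrite sz_w position_lt.
have label_lt (x : 'I_d * 'I_v) : (nth 0 w (x.1 * v + x.2)).-1 < v * d.
  by have := w_iota x; rewrite mem_iota; lia.
exists [ffun x => Ordinal (label_lt x)].
apply: (@eq_from_nth _ 0) => [|p]; rewrite size_reading //.
move=> /position_surj[i [a ->]].
rewrite nth_reading ffunE /= prednK //.
by have := w_iota (i, a); rewrite mem_iota => /andP[].
Qed.

Lemma diamondsP D :
  reflect (uniq (reading D) /\ forall i a b, diamond_lt a b ->
             nth 0 (reading D) (i * v + a) < nth 0 (reading D) (i * v + b))
          (D \in diamonds v d).
Proof.
rewrite inE reading_uniq; apply: (iffP andP) => -[-> incr]; split=> //.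
  move=> i a b lt_ab; rewrite !nth_reading ltnS.
  by have /forallP/(_ i)/forallP/(_ a)/forallP/(_ b)/implyP := incr; apply.
apply/forallP=> i; apply/forallP=> a; apply/forallP=> b; apply/implyP=> lt_ab.
by rewrite -ltnS -!nth_reading incr.
Qed.

Lemma diamond_lt_succ a b :
  b = a.+1 :> nat -> diamond_lt a b = ~~ allows_descent v a.
Proof.
by have := ltn_ord b; rewrite /diamond_lt /allows_descent => /[swap] ->; lia.
Qed.

Lemma descents_allowedP D :
  reflect (forall i a, (i * v + a).+1 < v * d ->
             nth 0 (reading D) (i * v + a).+1 < nth 0 (reading D) (i * v + a) ->
             allows_descent v a)
          (all2 implb (descents (reading D)) (allowed_descents v (v * d).-1)).
Proof.
have mod_position i a : (i * v + a) %% v = a by rewrite modnMDl modn_small.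
apply: (iffP (all2_implbP _ _)) => [[_ allowed] i a lt_p des_p|allowed].
  have := allowed (i * v + a); rewrite nth_descents ?size_reading // des_p.
  by rewrite nth_mkseq ?mod_position; [apply|lia].
split=> [|p des_p]; first by rewrite !size_mkseq size_reading.
have lt_p : p < (v * d).-1.
  by have := nth_true_lt des_p; rewrite size_mkseq size_reading.
have [i [a def_p]] := @position_surj p ltac:(lia).
rewrite nth_mkseq // def_p mod_position; apply: (allowed i); first by lia.
by rewrite -def_p -nth_descents // size_reading; lia.
Qed.

Local Notation avoiders := (diamonds_avoiding v d forbidden_patterns).

Hypothesis v_gt1 : 1 < v.

Lemma far_increasing_diamonds D :
  uniq (reading D) -> far_increasing (reading D) ->
  (D \in diamonds v d) =
  all2 implb (descents (reading D)) (allowed_descents v (v * d).-1).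
Proof.
move=> D_uniq far; apply/diamondsP/descents_allowedP.
  move=> [_ incr] i a lt_p; apply: contraTT => not_allowed.
  have lt_a : a.+1 < v.
    by move: not_allowed; rewrite /allows_descent; have := ltn_ord a; lia.
  rewrite -leqNgt ltnW // -addnS; apply: (incr i a (Ordinal lt_a)).
  by rewrite diamond_lt_succ.
move=> allowed; split=> // i a b lt_ab.
have lt_p := position_lt i b.
have [le_ba|lt_a1b|eq_b] := ltngtP b a.+1.
- by move: lt_ab; rewrite /diamond_lt; have := ltn_ord a; lia.
- by apply: far; rewrite ?size_reading //; lia.
rewrite diamond_lt_succ // in lt_ab; rewrite eq_b addnS in lt_p *.
rewrite uniq_nth_ltnNgt ?size_reading //; try lia.
by apply: contra lt_ab; apply: allowed.
Qed.

Lemma diamonds_avoidingP D :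
  reflect [/\ uniq (reading D), far_increasing (reading D)
            & all2 implb (descents (reading D)) (allowed_descents v (v * d).-1)]
          (D \in avoiders).
Proof.
rewrite inE; apply: (iffP andP).
  move=> [D_diamond /avoids_231_312_321P far].
  have [D_uniq _] := diamondsP _ D_diamond.
  by split; rewrite -?far_increasing_diamonds //; apply: far.
move=> [D_uniq far allowed]; rewrite far_increasing_diamonds //.
by split=> //; apply/avoids_231_312_321P.
Qed.

Lemma descents_reading_inj :
  {in avoiders &, injective (descents \o @reading v d)}.
Proof.
move=> D D' /diamonds_avoidingP[D_uniq far _].
move=> /diamonds_avoidingP[D'_uniq far' _] eq_des; apply: reading_inj.
have perm_iota D0 : uniq (reading D0) -> perm_eq (reading D0) (iota 1 (v * d)).
  move=> D0_uniq; apply: (uniq_subset_perm D0_uniq (@reading_sub_iota D0)).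
  by rewrite size_iota size_reading.
apply: order_iso_perm_eq.
  by apply: far_increasing_order_iso; rewrite ?size_reading.
by rewrite (permPl (perm_iota _ _)) // perm_sym perm_iota.
Qed.

Lemma mem_descents_reading (b : bitseq) : 0 < d ->
  (b \in [seq descents (reading D) | D in avoiders]) =
  (b \in sparse_words false (allowed_descents v (v * d).-1)).
Proof.
move=> d_gt0; rewrite mem_sparse_words_false; apply/imageP/andP.
  move=> [D /diamonds_avoidingP[_ far allowed] ->].
  by rewrite far_increasing_sparse_descents.
move=> [sparse_b allowed].
have sz_b : (size b).+1 = v * d.
  have [-> _] := all2_implbP _ _ allowed.
  by rewrite size_mkseq prednK // muln_gt0 d_gt0 ltnW.
have [||D def_D] := @reading_surj (swap_word b).
- by rewrite size_mkseq.
- by rewrite -sz_b; apply: swap_word_sub_iota.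
exists D; last by rewrite def_D descents_swap_word.
apply/diamonds_avoidingP; rewrite def_D descents_swap_word //.
by split; [exact: swap_word_uniq|exact: swap_word_far_increasing|].
Qed.

Lemma perm_descents_reading : 0 < d ->
  perm_eq [seq descents (reading D) | D in avoiders]
          (sparse_words false (allowed_descents v (v * d).-1)).
Proof.
move=> d_gt0; apply: uniq_perm => [||b]; last exact: mem_descents_reading.
  rewrite map_inj_in_uniq ?enum_uniq // => D D'.
  by rewrite !mem_enum; apply: descents_reading_inj.
exact: sparse_words_uniq.
Qed.

End Reading.

Local Open Scope ring_scope.

Theorem theorem4p5 (v d : nat) (hv : (4 <= v)%N) (hd : (1 <= d)%N) :
  \sum_(D in diamonds_avoiding v d [:: [:: 2; 3; 1]; [:: 3; 1; 2]; [:: 3; 2; 1]]%N)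
     'X^(des (reading D))
  = (1 + 'X) ^+ (d - 1)
    * (\sum_(0 <= k < ((v - 2) %/ 2).+1) 'X^k *+ 'C(v - 2 - k, k)) ^+ d
  :> {poly int}.
Proof.
under eq_bigr do rewrite des_descents.
rewrite -(big_image _ _ _ _ (fun b : bitseq => 'X^(count id b))).
rewrite (perm_big _ (perm_descents_reading _ hd)) ?(ltnW (ltnW hv)) //.
rewrite -/(sparse_gf 'X false _).
case: d hd => // d _.
by rewrite sparse_gf_allowed_descents ?subn1 ?fib_poly_half //; lia.
Qed.
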